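(* Let $n\ge 1$ be an odd integer and $q=2^n$. If $n\geq 7$, then $t^-(q):=q-\sqrt{2q}+1$ is divisible by a primitive prime divisor $\mathrm{ppd}(2,4n)$ (of $q^2+1$). In all cases, $t^+(q):=q+\sqrt{2q}+1$ is divisible by a primitive prime divisor $\mathrm{ppd}(2,4n)$ (of $q^2+1$).
   Context: For integers $a,m\geq 2$, a primitive prime divisor $\mathrm{ppd}(a,m)$ is a prime divisor of $a^m-1$ that does not divide $\prod_{j=1}^{m-1}(a^j-1)$. Note $q^2+1=t^-(q)t^+(q)$, and $t^\pm(q)$ are integers since $n$ is odd. *)

(* Defs.v *)
From mathcomp Require Import all_boot all_order all_algebra all_field.

Set Implicit Arguments.
Unset Strict Implicit.
Unset Printing Implicit Defensive.

Import GRing.Theory Num.Theory.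

Local Open Scope nat_scope.

Definition primitive_prime_divisor (a m p : nat) : bool :=
  [&& 1 < a, 1 < m, prime p, p %| a ^ m - 1
    & ~~ (p %| \prod_(1 <= j < m) (a ^ j - 1))].

Local Open Scope ring_scope.

(* [sqrtC] is the genuine square root in the algebraic numbers (nonnegative on
   nonnegative reals), so no integer rounding is built in: that the values are
   integers for q = 2 ^ n with n odd is not assumed. *)
Definition tminus (q : nat) : algC := q%:R - sqrtC (2 * q)%:R + 1.

Definition tplus (q : nat) : algC := q%:R + sqrtC (2 * q)%:R + 1.

(* Main.v *)
Require Import Defs.
From mathcomp Require Import all_boot all_order all_algebra all_field.
From mathcomp Require Import ring lra zify.

(** Put [z = 1 + i] or [z = - (1 + i)] and let [A k] be the norm of the Gaussian
    integer [z ^ k - 1].  For [k] odd, [A k] is one of the two factors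
    [2 ^ k +- 2 ^ ((k + 1) / 2) + 1] of [4 ^ k + 1], the other choice of [z]
    giving the other factor ([gauss_normE]), and [A k] divides [A n] whenever
    [k] divides [n] ([gauss_norm_dvd]).  So it is enough to find, for [n >= 7],
    a primitive prime divisor of [A n] for each choice of [z].

    Consider the Moebius product of [A d ^ mu (n / d)] over the divisors [d] of
    [n], the norm of the [n]-th cyclotomic polynomial at [z].  A prime [p]
    dividing [A n] has [4 * e] as the order of 2, with [e] a divisor of [n]
    ([order_of_minus1]), and is primitive when [e = n].  If [e < n], lifting
    the exponent shows that the valuations of the [A d] cancel in the product,
    up to a single factor [p] when [p] is the largest prime [s] of [n]
    ([delta_logn_gauss_norm]).  Hence, if [A n] had no primitive prime divisor,
    the product would be at most [s].

    On the other hand [A d] is close to [2 ^ d], and the product of the errors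
    over all odd [d] converges: it stays below 65/8 ([prod_aurifeuille_le]).
    So the Moebius product is at least [8 / 65 * 2 ^ totient n], and this is
    larger than [s] as soon as [n >= 7] ([prime_lt_pow_totient]).  The factors
    [t+] for [n = 1, 3, 5] are the primes 5, 13 and 41. *)

Set Implicit Arguments.
Unset Strict Implicit.
Unset Printing Implicit Defensive.
Import GRing.Theory Num.Theory Order.TTheory.

(** * The two factors as norms of Gaussian integers *)

Section GaussianNorms.
Local Open Scope ring_scope.

(** Multiplication by [1 + i] (or [- (1 + i)], when [b] holds) on [Z[i]], so
    that the determinant is the norm of Gaussian integers. *)
Definition gauss_mx (b : bool) : 'M[int]_2 :=
  \matrix_(i, j) ((-1) ^+ b * (if (i < j)%N then -1 else 1)).

(** The norm of [(+-(1 + i)) ^ k - 1]. *)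
Definition gauss_norm (b : bool) (k : nat) : nat :=
  `|\det (gauss_mx b ^+ k - 1)|%N.

Lemma det_mx22 (R : comPzRingType) (M : 'M[R]_2) :
  \det M = M 0 0 * M 1 1 - M 0 1 * M 1 0.
Proof.
rewrite (expand_det_row _ 0) 2!big_ord_recl big_ord0 addr0 /cofactor !det_mx11.
rewrite !mxE /= !expr0 !mul1r /bump /= expr1 mulN1r mulrN.
by congr (M _ _ * M _ _ - M _ _ * M _ _); apply: val_inj.
Qed.

(** [z ^ k - 1] divides [z ^ (k * r) - 1], and norms are multiplicative.  This
    is the reason for describing [t+-] by norms: the closed formulas hide how
    the signs at [k] and [k * r] have to be matched. *)
Lemma gauss_norm_dvd b k r : (gauss_norm b k %| gauss_norm b (k * r))%N.
Proof.
apply/dvdnP; exists `|\det (\sum_(i < r) (gauss_mx b ^+ k) ^+ i)|%N.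
by rewrite /gauss_norm exprM subrX1 det_mulmx abszM mulnC.
Qed.

(** The factors [t+] (for [s = true]) and [t-] at [q = 2 ^ k]; the truncated
    subtraction is a true one since [k.+1./2 <= k] for [k] odd. *)
Definition aurifeuille (s : bool) (k : nat) : nat :=
  (if s then 2 ^ k + 1 + 2 ^ k.+1./2 else 2 ^ k + 1 - 2 ^ k.+1./2)%N.

Lemma gauss_mx4 b : gauss_mx b ^+ 4 = (- 4)%:M.
Proof.
apply/matrixP => i j; rewrite !exprS expr0 mulr1.
do 3!rewrite !mxE !big_ord_recl !big_ord0; rewrite !mxE.
by case: b; case: i j => -[|[|//]] ? [] [|[|//]].
Qed.

Lemma det_gauss_mx1 b (c : int) :
  \det (c *: gauss_mx b - 1) = 2 * c ^+ 2 + 1 - 2 * ((-1) ^+ b * c).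
Proof.
by rewrite det_mx22 !mxE /=; case: b; rewrite ?expr0 ?expr1; ring.
Qed.

Lemma det_gauss_mx3 b (c : int) :
  \det (c *: gauss_mx b ^+ 3 - 1) = 8 * c ^+ 2 + 1 + 4 * ((-1) ^+ b * c).
Proof.
rewrite det_mx22 !exprS expr0 mulr1.
do 2!rewrite !mxE !big_ord_recl !big_ord0; rewrite !mxE /=.
by case: b; rewrite ?expr0 ?expr1; ring.
Qed.

Lemma signed_pow4 j : (- 4) ^+ j = (-1) ^+ odd j * (4 ^ j)%N%:Z :> int.
Proof. by rewrite signr_odd -natz natrX -exprMn mulN1r. Qed.

(** [z ^ 4 = - 4] leaves the cases [k = 1] and [k = 3] modulo 4, and the sign
    [c] depends on [k] modulo 8 only.  The same [c] serves both values of [b],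
    so the two norms are the two factors, in some order. *)
Lemma gauss_normE k : odd k ->
  exists c : bool, forall b, gauss_norm b k = aurifeuille (b (+) c) k.
Proof.
move=> k_odd.
have pow4 j : (2 ^ (2 * j) = 4 ^ j)%N by rewrite expnM.
have pow16 j : (2 ^ (4 * j) = 4 ^ j * 4 ^ j)%N by rewrite expnM -expnMn.
have mul4 b j : gauss_mx b ^+ (4 * j) = ((- 4) ^+ j)%:M.
  by rewrite exprM gauss_mx4 rmorphXn.
have [j [jE|jE]] : exists j, (k = 4 * j + 1 \/ k = 4 * j + 3)%N.
  by exists (k %/ 4)%N; lia.
- exists (odd j) => b; rewrite /gauss_norm /aurifeuille jE exprD mul4.
  rewrite expr1 -[_ * gauss_mx b]/(_ *m _) mul_scalar_mx det_gauss_mx1 signed_pow4.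
  have -> : ((4 * j + 1).+1./2 = 2 * j + 1)%N by lia.
  rewrite (expnD 2 (4 * j)) (expnD 2 (2 * j)) pow4 pow16 !expn1.
  have : (1 <= 4 ^ j)%N by rewrite expn_gt0.
  move: (4 ^ j)%N => m m1; have mm : (m <= m * m)%N by rewrite leq_pmulr.
  case: b (odd j) => -[] /=; rewrite ?expr0 ?expr1 ?expr2;
    by rewrite ?(mul1r, mulN1r, mulrN, mulNr, opprK); lia.
- exists (~~ odd j) => b; rewrite /gauss_norm /aurifeuille jE exprD mul4.
  rewrite -[_ * gauss_mx b ^+ 3]/(_ *m _) mul_scalar_mx det_gauss_mx3 signed_pow4.
  have -> : ((4 * j + 3).+1./2 = 2 * j + 2)%N by lia.
  rewrite (expnD 2 (4 * j)) (expnD 2 (2 * j)) pow4 pow16.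
  rewrite -[(2 ^ 3)%N]/8%N -[(2 ^ 2)%N]/4%N.
  have : (1 <= 4 ^ j)%N by rewrite expn_gt0.
  move: (4 ^ j)%N => m m1; have mm : (m <= m * m)%N by rewrite leq_pmulr.
  case: b (odd j) => -[] /=; rewrite ?expr0 ?expr1 ?expr2;
    by rewrite ?(mul1r, mulN1r, mulrN, mulNr, opprK); lia.
Qed.
End GaussianNorms.

Lemma aurifeuille_mul k : odd k ->
  aurifeuille true k * aurifeuille false k = 4 ^ k + 1.
Proof.
move=> k_odd; rewrite /aurifeuille -[4]/(2 ^ 2) -expnM.
have -> : 2 * k = k + k by lia.
have := erefl (2 ^ (k.+1./2 + k.+1./2)).
rewrite [LHS]expnD (_ : k.+1./2 + k.+1./2 = k.+1); last lia.
rewrite expnS expnD.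
have : 2 ^ k.+1./2 <= 2 ^ k by rewrite leq_exp2l; lia.
move: (2 ^ k.+1./2) (2 ^ k) => s u su sE; nia.
Qed.

Lemma gauss_norm_mul b k : odd k ->
  gauss_norm b k * gauss_norm (~~ b) k = 4 ^ k + 1.
Proof.
move=> k_odd; have [c E] := gauss_normE k_odd.
by rewrite !E -aurifeuille_mul // ; case: b c {E} => -[] //=; rewrite mulnC.
Qed.

Lemma gauss_norm_gt0 b k : odd k -> 0 < gauss_norm b k.
Proof. by move/(gauss_norm_mul b); lia. Qed.

Lemma gauss_norm_le b k : odd k -> gauss_norm b k <= aurifeuille true k.
Proof.
move=> k_odd; have [c ->] := gauss_normE k_odd.
by rewrite /aurifeuille; case: (b (+) c); lia.
Qed.

Lemma dvd_pow4_odd p k : p %| 4 ^ k + 1 -> 0 < k -> odd p.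
Proof.
move=> p_k k_gt0; apply: (dvdn_odd p_k); rewrite addn1 /= oddX; lia.
Qed.

(** A common prime would divide the difference of the two factors, a power
    of 2, whereas their product [4 ^ k + 1] is odd. *)
Lemma gauss_norm_disjoint b k p : odd k -> prime p ->
  p %| gauss_norm b k -> ~~ (p %| gauss_norm (~~ b) k).
Proof.
move=> k_odd p_pr pb; apply/negP => pb'.
have p_odd : odd p.
  apply: (@dvd_pow4_odd p k); last by case: k k_odd {pb pb'}.
  by rewrite -(gauss_norm_mul b) // dvdn_mulr.
suff : p %| 2 ^ k.+1./2.+1.
  by rewrite Euclid_dvdX // => /andP[]; rewrite dvdn_prime2 //; case: eqP p_odd => [->|].
have [c E] := gauss_normE k_odd.
have : p %| aurifeuille true k - aurifeuille false k.
  by apply: dvdn_sub; move: pb pb'; rewrite !E; case: b c {E} => -[].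
congr (p %| _); rewrite /aurifeuille expnS.
have : 2 ^ k.+1./2 <= 2 ^ k by rewrite leq_exp2l; lia.
lia.
Qed.

(** * Orders of 2 and lifting the exponent *)

(** The order of 2 modulo [p] divides [4 * n] but not [2 * n]; as [n] is odd,
    it is [4 * e] for a divisor [e] of [n]. *)
Lemma order_of_minus1 p n : odd n -> prime p -> p %| 4 ^ n + 1 ->
  exists e, [/\ e %| n, 4 * e %| p.-1,
    forall j, (p %| 2 ^ j - 1) = (4 * e %| j)
    & forall k, odd k -> (p %| 4 ^ k + 1) = (e %| k)].
Proof.
move=> n_odd p_pr pn.
have pC := pchar_Fp p_pr.
have p_odd := dvd_pow4_odd pn (odd_gt0 n_odd).
have dvd_sub j : (p %| 2 ^ j - 1) = ((2%:R : 'F_p) ^+ j == 1)%R.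
  rewrite (dvdn_pcharf pC) natrB ?expn_gt0 // natrX subr_eq0 //.
have dvd_add k : (p %| 4 ^ k + 1) = ((2%:R : 'F_p) ^+ (2 * k) == -1)%R.
  rewrite (dvdn_pcharf pC) natrD -[4]/(2 ^ 2) -expnM natrX addr_eq0 //.
have m1n1 : (-1 != 1 :> 'F_p)%R.
  rewrite -subr_eq0 -opprD oppr_eq0 -(natrD _ 1 1) -(dvdn_pcharf pC) /= addn1.
  by rewrite dvdn_prime2 //; case: eqP p_odd => [->|].
have two_n : ((2%:R : 'F_p) ^+ (4 * n) = 1)%R.
  rewrite (_ : 4 * n = 2 * n * 2); last by lia.
  rewrite exprM.
  move: pn; rewrite dvd_add => /eqP ->.
  by rewrite sqrrN expr1n.
have [|o o_prim o_n] := prim_order_exists _ two_n; first by lia.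
have o_dvd := prim_order_dvd o_prim.
have four_o : 4 %| o.
  have : ~~ (o %| 2 * n) by move: pn; rewrite dvd_add o_dvd => /eqP ->.
  case/dvdnP: o_n => q qo o2n; have q_odd : odd q.
    apply: contraR o2n => q_even; apply/dvdnP; exists q./2; nia.
  rewrite -(@Gauss_dvdr _ q) -?qo ?dvdn_mulr //.
  by rewrite (@coprimeXl 2 2 q) // coprime2n.
have oE : o = 4 * (o %/ 4) by rewrite mulnC divnK.
have e_n : o %/ 4 %| n by rewrite -(@dvdn_pmul2l 4) // -oE.
have e_odd := dvdn_odd e_n n_odd.
exists (o %/ 4); rewrite -oE; split=> // [|j|k k_odd].
- rewrite o_dvd -dvd_sub -(@Gauss_dvdr _ 2); last first.
    by rewrite coprime_sym coprime2n.
  rewrite mulnBr -expnS prednK ?prime_gt0 // -eqn_mod_dvd; first exact/eqP/fermat_little.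
  by rewrite -[leqLHS]expn1 leq_exp2l ?prime_gt0.
- by rewrite dvd_sub o_dvd.
rewrite dvd_add; apply/eqP/idP => [k1|/dvdnP[r kE]].
  rewrite -(@dvdn_pmul2l 4) // -oE o_dvd (_ : 4 * k = 2 * k * 2); last by lia.
  by rewrite exprM k1 sqrrN expr1n.
have /eqP : (((2%:R : 'F_p) ^+ (2 * (o %/ 4))) ^+ 2 = 1)%R.
  by apply/eqP; rewrite -exprM -o_dvd mulnAC -[2 * 2]/4 -oE.
rewrite -[X in (_ == X)%R](expr1n _ 2) eqf_sqr => /orP[/eqP|/eqP e1].
  move=> /eqP; rewrite -o_dvd => /dvdn_leq-/(_ _)/implyP.
  by move: e_odd oE; case: (o %/ 4) => // e _ ->; lia.
move: k_odd; rewrite kE oddM => /andP[r_odd _].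
by rewrite mulnCA mulnC exprM e1 -signr_odd r_odd expr1.
Qed.

Lemma expr_mod_sqr (R : comPzRingType) (y : R) s :
  exists t, (y ^+ s = 1 + (y - 1) *+ s + (y - 1) ^+ 2 * t)%R.
Proof.
elim: s => [|s [t IH]]; first by exists 0%R; rewrite expr0; ring.
exists (s%:R + t * y)%R; rewrite exprSr IH mulrS -!(mulr_natl (y - 1)); ring.
Qed.

Lemma geometric_mod_sqr (R : comPzRingType) (y : R) s :
  exists t, (\sum_(i < s) y ^+ i =
             s%:R + (y - 1) *+ 'C(s, 2) + (y - 1) ^+ 2 * t)%R.
Proof.
elim: s => [|s [t IH]].
  by exists 0%R; rewrite big_ord0 bin0n /= !mulr0n mulr0 !addr0.
have [u ys] := expr_mod_sqr y s.
exists (t + u)%R; rewrite big_ord_recr /= IH ys binS bin1 mulrnDr -natr1; ring.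
Qed.

(** Lifting the exponent, one prime at a time: the cofactor of [y - 1] in
    [y ^+ s - 1] is [s] modulo [p] when [s != p], and [p] modulo [p ^ 2] when
    [s = p], because then [p] divides ['C(p, 2)]. *)
Lemma logn_exprB1_prime p s (y : int) : prime p -> odd p -> prime s ->
    (p %| (y - 1)%R)%Z -> (y != 1)%R ->
  logn p `|(y ^+ s - 1)%R|%N = logn p `|(y - 1)%R|%N + (p == s).
Proof.
move=> p_pr p_odd s_pr /dvdzP[c yE] y_n1.
have [t sumE] := geometric_mod_sqr y s.
have [z [zE z_p]] : exists z : int,
    (\sum_(i < s) y ^+ i)%R = (z * p%:Z ^+ (p == s))%R /\ ~~ (p %| z)%Z.
  rewrite sumE yE; have [<-|p_s] := eqVneq p s.
    have /dvdnP[d ->] : p %| 'C(p, 2).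
      by rewrite prime_dvd_bin //= ltn_neqAle prime_gt1 // andbT; case: eqP p_odd => [<-|].
    exists (1 + p%:Z * (c * d%:Z + c ^+ 2 * t))%R; split.
      by rewrite -(mulr_natl (c * p)%R) natrM !natz expr1; ring.
    rewrite rpredDr ?dvdz_mulr //.
    by rewrite dvdzE /= dvdn1; case: eqP p_pr => [->|].
  exists (s%:Z + p%:Z * (c *+ 'C(s, 2) + p%:Z * c ^+ 2 * t))%R; split.
    by rewrite -(mulr_natl (c * p)%R) -(mulr_natl c) natz expr0; ring.
  rewrite rpredDr ?dvdz_mulr //.
  by rewrite dvdzE /= dvdn_prime2.
have z_gt0 : 0 < `|z|%N by rewrite absz_gt0; apply: contra z_p => /eqP ->.
rewrite subrX1 abszM zE abszM abszX absz_nat lognM ?absz_gt0 ?subr_eq0 //; last first.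
  by rewrite muln_gt0 z_gt0 expn_gt0 (prime_gt0 p_pr).
rewrite lognM ?expn_gt0 ?(prime_gt0 p_pr) // pfactorK //.
by rewrite (@logn_coprime p `|z|%N) // prime_coprime.
Qed.

(** * Moebius differences *)

(** The multiples of [k] by the products of the sublists of [ps]; [b] selects
    the sublists leaving out an even ([true]) or odd ([false]) number of
    primes.  If [k * \prod_(r <- ps) r = n] and [ps] lists the primes of [n],
    these are the divisors [d] of [n] where the Moebius function of [n / d] is
    1, respectively -1. *)
Fixpoint signed_points (b : bool) (ps : seq nat) (k : nat) : seq nat :=
  if ps is r :: ps' then signed_points b ps' (r * k) ++ signed_points (~~ b) ps' k
  else if b then [:: k] else [::].

(** Moebius inversion as an iterated difference: [delta (primes n) f k] is the
    sum over [d] dividing [n] of [mu (n / d) * f d], for [k] as above. *)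
Fixpoint delta (ps : seq nat) (f : nat -> int) (k : nat) : int :=
  if ps is r :: ps' then (delta ps' f (r * k) - delta ps' f k)%R else f k.

Lemma delta_signed_points ps f k :
  delta ps f k = (\sum_(d <- signed_points true ps k) f d
                  - \sum_(d <- signed_points false ps k) f d)%R.
Proof.
elim: ps k => [|r ps IH] k /=; first by rewrite big_seq1 big_nil subr0.
rewrite !IH !big_cat /=; ring.
Qed.

Lemma delta_ext ps f g k :
  (forall d, d %| \prod_(r <- ps) r -> f (d * k) = g (d * k)) ->
  delta ps f k = delta ps g k.
Proof.
elim: ps k => [|r ps IH] k fg /=; first by have := fg 1; rewrite mul1n; apply.
rewrite !IH // => d d_ps.
- by apply: fg; rewrite big_cons dvdn_mull.
- by rewrite mulnA; apply: fg; rewrite big_cons mulnC dvdn_mul.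
Qed.

Lemma delta0 ps k : delta ps (fun=> 0%R) k = 0%R.
Proof. by elim: ps k => [|r ps IH] k //=; rewrite !IH subrr. Qed.

Lemma deltaB ps f g k :
  delta ps (fun j => (f j - g j)%R) k = (delta ps f k - delta ps g k)%R.
Proof. by elim: ps k => [|r ps IH] k //=; rewrite !IH; ring. Qed.

Lemma delta_shift ps f r k :
  delta ps (fun j => f (r * j)) k = delta ps f (r * k).
Proof. by elim: ps k => [|s ps IH] k //=; rewrite !IH mulnCA. Qed.

(** The differences commute, so any prime can be treated first.  This reduces
    cancellations in [delta] to the comparison of [f (r * j)] and [f j]. *)
Lemma delta_rem r ps f k : r \in ps ->
  delta ps f k = delta (rem r ps) (fun j => (f (r * j) - f j)%R) k.
Proof.
elim: ps k => [|s ps IH] k //=; rewrite inE eq_sym.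
have [-> _|_ /= r_ps] := eqVneq s r; last by rewrite -!IH.
by rewrite deltaB delta_shift.
Qed.

Lemma delta_id ps (k : nat) :
  delta ps Posz k = (k%:Z * \prod_(r <- ps) (r%:Z - 1))%R.
Proof.
elim: ps k => [|r ps IH] k /=; first by rewrite big_nil mulr1.
by rewrite !IH big_cons PoszM; ring.
Qed.

Lemma dvdn_mul_prime r e m : prime r -> 0 < m -> logn r e <= logn r m ->
  (e %| r * m) = (e %| m).
Proof.
move=> r_pr m_gt0 em; apply/idP/idP => [e_rm|]; last exact: dvdn_mull.
have rm_gt0 : 0 < r * m by rewrite muln_gt0 (prime_gt0 r_pr).
have e_gt0 := dvdn_gt0 rm_gt0 e_rm.
apply/dvdn_partP => // p; rewrite mem_primes p_part => /and3P[p_pr _ _].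
rewrite pfactor_dvdn //; have [->//|p_r] := eqVneq p r.
have := dvdn_leq_log p rm_gt0 e_rm; rewrite lognM ?(prime_gt0 r_pr) //.
by rewrite (logn_prime p r_pr) (negPf p_r).
Qed.

Lemma prime_notdvd_prod r ps d : prime r -> all prime ps -> r \notin ps ->
  d %| \prod_(s <- ps) s -> ~~ (r %| d).
Proof.
move=> r_pr ps_pr r_ps d_ps; apply/negP => /dvdn_trans/(_ d_ps).
elim: ps ps_pr r_ps {d_ps} => [|s ps IH] /=.
  by rewrite big_nil dvdn1; case: eqP r_pr => [->|].
move=> /andP[s_pr ps_pr]; rewrite inE negb_or big_cons Euclid_dvdM // dvdn_prime2 //.
by move=> /andP[/negPf-> /(IH ps_pr)].
Qed.

Lemma logn_mul_notdvd r d k : prime r -> 0 < k -> ~~ (r %| d) ->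
  logn r (d * k) = logn r k.
Proof.
move=> r_pr k_gt0 r_d; rewrite lognM //; last by case: d r_d => //; rewrite dvdn0.
by rewrite logn_coprime // prime_coprime.
Qed.

(** The condition [e %| j] is the conjunction over the primes [r] of the
    conditions [logn r e <= logn r j], and the difference at [r] of such a
    step function is 0 or a step again. *)
Lemma delta_dvdn e ps k : uniq ps -> all prime ps -> 0 < k ->
  (delta ps (fun j => Posz (e %| j)) k <= 1)%R.
Proof.
elim: ps k => [|r ps IH] k /=; first by case: (e %| k).
move=> /andP[r_ps ps_uniq] /andP[r_pr ps_pr] k_gt0.
have logd d : d %| \prod_(s <- ps) s -> logn r (d * k) = logn r k.
  by move=> /(prime_notdvd_prod r_pr ps_pr r_ps); apply: logn_mul_notdvd.
have d_gt0 d : d %| \prod_(s <- ps) s -> 0 < d * k.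
  move=> /(prime_notdvd_prod r_pr ps_pr r_ps); rewrite muln_gt0 k_gt0 andbT.
  by case: d => //; rewrite dvdn0.
have [ek|ke] := leqP (logn r e) (logn r k).
  rewrite -(delta_shift ps _ r) -deltaB (@delta_ext _ _ (fun=> 0%R)) ?delta0 // => d d_ps.
  by rewrite dvdn_mul_prime ?subrr ?d_gt0 // logd.
rewrite (@delta_ext ps _ (fun=> 0%R) k) ?delta0 ?subr0 => [|d d_ps].
  by apply: IH => //; rewrite muln_gt0 (prime_gt0 r_pr).
case: (boolP (e %| d * k)) => // /(dvdn_leq_log r (d_gt0 _ d_ps)).
by rewrite logd // leqNgt ke.
Qed.

Lemma signed_points_mul b ps k d : d \in signed_points b ps k ->
  exists2 c, c %| \prod_(r <- ps) r & d = c * k.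
Proof.
elim: ps b k => [|r ps IH] b k /=.
  by case: b => //; rewrite inE => /eqP->; exists 1; rewrite ?mul1n.
rewrite mem_cat big_cons => /orP[/IH[c c_ps ->]|/IH[c c_ps ->]].
  by exists (c * r); rewrite ?mulnA // mulnC dvdn_mul.
by exists c; rewrite // dvdn_mull.
Qed.

(** The [r]-adic valuation tells the points that use [r] from the others. *)
Lemma signed_points_uniq ps k : uniq ps -> all prime ps -> 0 < k ->
  uniq (signed_points true ps k ++ signed_points false ps k).
Proof.
elim: ps k => [|r ps IH] k //= /andP[r_ps ps_uniq] /andP[r_pr ps_pr] k_gt0.
have rk_gt0 : 0 < r * k by rewrite muln_gt0 (prime_gt0 r_pr).
set P := signed_points true ps; set M := signed_points false ps.
have perm : perm_eq ((P (r * k) ++ M k) ++ M (r * k) ++ P k)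
                    ((P (r * k) ++ M (r * k)) ++ P k ++ M k).
  by rewrite -!catA perm_cat2l perm_catCA perm_cat2l perm_catC.
rewrite (perm_uniq perm) cat_uniq !IH //= andbT.
have logd d : d \in P k ++ M k -> logn r d = logn r k.
  rewrite mem_cat => dk.
  have [c c_ps ->] : exists2 c, c %| \prod_(r <- ps) r & d = c * k.
    by case/orP: dk => /signed_points_mul.
  exact: logn_mul_notdvd (prime_notdvd_prod r_pr ps_pr r_ps c_ps).
apply/hasP => -[d /logd d_k].
rewrite mem_cat => drk.
have [c c_ps dE] : exists2 c, c %| \prod_(r <- ps) r & d = c * (r * k).
  by case/orP: drk => /signed_points_mul.
move: d_k; rewrite dE logn_mul_notdvd ?(prime_notdvd_prod _ _ r_ps) //.
by rewrite lognM ?(prime_gt0 r_pr) // logn_prime // eqxx; lia.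
Qed.

(** * Sizes of the factors *)

(** How much the larger factor exceeds its main term [2 ^ d]. *)
Definition excess (d : nat) : rat := ((aurifeuille true d)%:R / 2 ^+ d)%R.

Lemma excess_double j :
  excess (j.*2.+1) = (1 + (2 ^+ j)^-1 + 2^-1 * (2 ^+ j)^-1 ^+ 2)%R.
Proof.
rewrite /excess /aurifeuille (_ : (j.*2.+1).+1./2 = j.+1); last by lia.
rewrite !natrD !natrX -muln2 !exprS exprM.
have : (2 ^+ j != 0 :> rat)%R by rewrite expf_neq0.
by move: (2 ^+ j)%R => u u0; field.
Qed.

Lemma excess_ge1 d : (1 <= excess d)%R.
Proof.
rewrite /excess ler_pdivlMr ?exprn_gt0 // mul1r -natrX ler_nat /aurifeuille; lia.
Qed.

(** The factor [1 - 2 / 2 ^ J] makes the induction work: with [x = 1 / 2 ^ J],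
    [(1 + x + x ^ 2 / 2) * (1 - 2 * x) <= 1 - x].  The constant 65/8 is twice the
    product 5/2 * 13/8 of the first two terms, so that equality holds at the
    start. *)
Lemma prod_excess_le J :
  (\prod_(j < J.+2) excess (j.*2.+1) <= 65%:R / 8%:R * (1 - 2 * (2 ^+ J.+2)^-1))%R.
Proof.
elim: J => [|J IH].
  rewrite 2!big_ord_recr big_ord0 /= !excess_double expr0 expr1; lra.
rewrite big_ord_recr /=.
apply: le_trans
  (_ : (_ <= 65%:R / 8%:R * (1 - 2 * (2 ^+ J.+2)^-1) * excess (J.+2.*2.+1))%R) _.
  by apply: ler_wpM2r => //; apply: le_trans (excess_ge1 _).
have -> : (2 * (2 ^+ J.+3)^-1 = (2 ^+ J.+2)^-1 :> rat)%R.
  by rewrite [in LHS]exprS invfM mulrA divff ?mul1r.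
rewrite excess_double.
have : (0 < (2 ^+ J.+2 : rat)^-1)%R by rewrite invr_gt0 exprn_gt0.
move: ((2 ^+ J.+2)^-1)%R => x x0; nra.
Qed.

Lemma prod_excess_uniq s : uniq s -> all odd s ->
   (\prod_(d <- s) excess d <= 65%:R / 8%:R)%R.
Proof.
move=> s_uniq s_odd; pose h := map half s.
have sE : s = [seq j.*2.+1 | j <- h].
  rewrite -map_comp -[LHS]map_id; apply/eq_in_map => d /(allP s_odd) /=; lia.
have h_uniq : uniq h by move: s_uniq; rewrite {1}sE; apply: map_uniq.
have [J hJ] : exists J, {in h, forall j, j < J.+2}.
  exists (\sum_(j <- h) j) => j j_h; rewrite (big_rem j) //=; lia.
have h_perm : perm_eq h [seq j <- index_iota 0 J.+2 | j \in h].
  apply: uniq_perm; rewrite ?filter_uniq ?iota_uniq // => j.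
  by rewrite mem_filter mem_index_iota /=; case: (boolP (j \in h)) => // /hJ ->.
rewrite sE big_map (perm_big _ h_perm) big_filter big_mkcond big_mkord.
apply: le_trans (_ : (_ <= \prod_(j < J.+2) excess (j.*2.+1))%R) _.
  apply: ler_prod => j _; case: ifP => _; rewrite ?lexx ?andbT ?ler01 ?excess_ge1 //.
  by apply: le_trans (excess_ge1 _).
apply: le_trans (prod_excess_le _) _.
have : (0 < (2 ^+ J.+2 : rat)^-1)%R by rewrite invr_gt0 exprn_gt0.
move: ((2 ^+ J.+2)^-1)%R => x; lra.
Qed.

Lemma prod_aurifeuille_le s : uniq s -> all odd s ->
  8 * \prod_(d <- s) aurifeuille true d <= 65 * 2 ^ (\sum_(d <- s) d).
Proof.
move=> s_uniq s_odd; rewrite -(@ler_nat rat) !natrM natrX.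
have -> : ((\prod_(d <- s) aurifeuille true d)%:R =
    \prod_(d <- s) excess d * 2 ^+ (\sum_(d <- s) d) :> rat)%R.
  rewrite -prodrXr -big_split natr_prod /=; apply: eq_bigr => d _.
  by rewrite divfK // expf_neq0.
have := prod_excess_uniq s_uniq s_odd.
have : (0 < 2 ^+ (\sum_(d <- s) d) :> rat)%R by rewrite exprn_gt0.
move: (\prod_(d <- s) excess d)%R => x; nra.
Qed.

(** * Valuations of the norms *)

Lemma primitive_of_order n p : odd n -> prime p ->
  (forall j, (p %| 2 ^ j - 1) = (4 * n %| j)) -> primitive_prime_divisor 2 (4 * n) p.
Proof.
move=> n_odd p_pr ord_p; apply/and5P; split; rewrite ?ord_p //; first by lia.
rewrite big_nat; apply: (big_ind (fun x => ~~ (p %| x))) => [|x y px py|j].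
- by rewrite dvdn1; case: eqP p_pr => [->|].
- by rewrite Euclid_dvdM // negb_or px.
by move=> /andP[j_gt0 j_n]; rewrite ord_p gtnNdvd.
Qed.

Lemma logn_pow4_step p s k : prime p -> prime s -> odd s -> odd k ->
    p %| 4 ^ k + 1 ->
  logn p (4 ^ (s * k) + 1) = logn p (4 ^ k + 1) + (p == s).
Proof.
move=> p_pr s_pr s_odd k_odd p_k.
have p_odd := dvd_pow4_odd p_k (odd_gt0 k_odd).
have absE m : odd m -> `|((- 4%:Z) ^+ m - 1)%R|%N = 4 ^ m + 1.
  move=> m_odd; rewrite exprNn -signr_odd m_odd expr1 mulN1r -opprD abszN.
  by rewrite -natz -natrX natr1 natz addn1.
(* As [s] is odd, [y = - 4 ^ k] turns the sum of powers into a difference. *)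
have := @logn_exprB1_prime p s ((- 4%:Z) ^+ k)%R p_pr p_odd s_pr.
rewrite -exprM mulnC !absE ?oddM ?s_odd //; apply.
  by rewrite dvdzE absE.
by rewrite -subr_eq0 -absz_gt0 absE // addn1.
Qed.

(** A prime divisor of [gauss_norm b n] does not divide the opposite norm at
    [n], nor therefore the opposite norm at a divisor [k] of [n]: the whole
    [p]-part of [4 ^ k + 1] is in [gauss_norm b k]. *)
Lemma logn_gauss_norm b n k p : odd n -> k %| n -> prime p ->
  p %| gauss_norm b n -> logn p (gauss_norm b k) = logn p (4 ^ k + 1).
Proof.
move=> n_odd k_n p_pr p_n; have k_odd := dvdn_odd k_n n_odd.
rewrite -(gauss_norm_mul b k_odd) lognM ?gauss_norm_gt0 //.
rewrite [X in _ = _ + X]logn_coprime ?addn0 // prime_coprime //.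
apply: contra (gauss_norm_disjoint n_odd p_pr p_n) => /dvdn_trans; apply.
by have /dvdnP[r ->] := k_n; rewrite mulnC gauss_norm_dvd.
Qed.

Lemma logn_gauss_norm_step b n p e s k :
    odd n -> prime p -> p %| gauss_norm b n -> prime s -> s * k %| n ->
    (forall j, odd j -> (p %| 4 ^ j + 1) = (e %| j)) ->
    (e %| s * k) = (e %| k) ->
  logn p (gauss_norm b (s * k)) =
  logn p (gauss_norm b k) + (if p == s then e %| k else false).
Proof.
move=> n_odd p_pr p_n s_pr sk_n p_e e_s.
have := dvdn_odd sk_n n_odd; rewrite oddM => /andP[s_odd k_odd].
have k_n : k %| n by apply: dvdn_trans sk_n; apply: dvdn_mull.
rewrite !(@logn_gauss_norm b n) //.
have [e_k|e_k] := boolP (e %| k).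
  by rewrite logn_pow4_step ?p_e //; case: eqP.
rewrite !(@logn_coprime p) ?prime_coprime ?p_e ?e_s ?oddM ?s_odd //.
by case: ifP.
Qed.

Lemma logn_prod (I : eqType) p (s : seq I) (F : I -> nat) :
  {in s, forall i, 0 < F i} ->
  logn p (\prod_(i <- s) F i) = \sum_(i <- s) logn p (F i).
Proof.
elim: s => [|i s IH] F_gt0; first by rewrite !big_nil logn1.
have s_gt0 : {in s, forall i, 0 < F i} by move=> j js; rewrite F_gt0 // inE js orbT.
rewrite !big_cons lognM ?IH ?F_gt0 ?inE ?eqxx //.
by rewrite big_seq; apply: prodn_cond_gt0 => j /s_gt0.
Qed.

Lemma sum_Posz (I : Type) (s : seq I) (F : I -> nat) :
  Posz (\sum_(i <- s) F i) = (\sum_(i <- s) Posz (F i))%R.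
Proof. by elim: s => [|i s IH]; rewrite ?big_nil // !big_cons PoszD IH. Qed.

Lemma dvdn_prod_primes n : 0 < n -> \prod_(r <- primes n) r %| n.
Proof.
move=> n_gt0; rewrite [X in _ %| X]prod_prime_decomp // prime_decompE big_map /=.
rewrite big_seq [X in _ %| X]big_seq; apply: (big_ind2 (fun x y => x %| y)) => //.
  by move=> *; apply: dvdn_mul.
by move=> r r_n; rewrite -{1}[r]expn1 dvdn_exp2l // logn_gt0.
Qed.

(** The [p]-adic valuation of the Moebius product of the norms.  By
    [logn_gauss_norm_step], the first difference at a prime [r != p] vanishes
    unless [r] occurs in [e] as often as in [n]; so a suitable [r] makes the whole
    alternating sum zero.  Such an [r] exists unless [p] is the largest
    prime of [n]: if [p] divides [n], the largest prime of [n] exceeds [p] and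
    so cannot divide [e < p]; otherwise any prime divisor of [n / e] will do.
    When [p] is the largest prime of [n], the difference at [p] is the
    indicator of [e %| j], with alternating sum at most 1. *)
Lemma delta_logn_gauss_norm b n m p e : odd n -> 1 < n ->
    n = \prod_(r <- primes n) r * m -> prime p -> p %| gauss_norm b n ->
    e %| n -> e != n -> 4 * e %| p.-1 ->
    (forall j, odd j -> (p %| 4 ^ j + 1) = (e %| j)) ->
  (delta (primes n) (fun d => Posz (logn p (gauss_norm b d))) m
     <= Posz (max_pdiv n == p))%R.
Proof.
move=> n_odd n_gt1 nE p_pr p_n e_n e_neq e_p p_e.
have n_gt0 := ltnW n_gt1.
have m_gt0 : 0 < m by move: n_gt0; rewrite nE muln_gt0 => /andP[].
have primes_pr (r : nat) : r \in primes n -> prime r by rewrite mem_primes => /andP[].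
have e_lt : 4 * e <= p.-1 by apply: dvdn_leq e_p; have := prime_gt1 p_pr; lia.
have e_gt0 := dvdn_gt0 n_gt0 e_n.
have rem_pr (r : nat) : all prime (rem r (primes n)).
  by apply/allP => t /mem_rem; apply: primes_pr.
have step (r : nat) d : r \in primes n -> d %| \prod_(t <- rem r (primes n)) t ->
    (e %| r * (d * m)) = (e %| d * m) ->
  (Posz (logn p (gauss_norm b (r * (d * m))%N)) - Posz (logn p (gauss_norm b (d * m)%N)) =
   Posz (if p == r then e %| d * m else false)%N)%R.
  move=> r_n d_r e_r; rewrite (@logn_gauss_norm_step b n p e r) ?(primes_pr r r_n) //.
    by rewrite PoszD; lia.
  by rewrite [X in _ %| X]nE mulnA (big_rem r) //= !dvdn_mul.
have notdvd (r : nat) d :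
    r \in primes n -> d %| \prod_(t <- rem r (primes n)) t -> ~~ (r %| d).
  move=> r_n; apply: prime_notdvd_prod => //; first exact: primes_pr.
  by rewrite mem_rem_uniqF ?primes_uniq.
have logm (r : nat) : r \in primes n -> logn r n = (logn r m).+1.
  move=> r_n; have r_pr := primes_pr r r_n.
  rewrite nE (big_rem r) //= -mulnA lognM ?(prime_gt0 r_pr) //; last first.
    by move: n_gt0; rewrite [X in 0 < X]nE (big_rem r) //= -mulnA muln_gt0 => /andP[].
  rewrite (logn_prime r r_pr) eqxx (@logn_mul_notdvd r) ?notdvd //.
have [sp|sp] := eqVneq (max_pdiv n) p.
  have p_in : p \in primes n by rewrite -sp pi_max_pdiv.
  rewrite (delta_rem _ _ p_in) (@delta_ext _ _ (fun j => Posz (e %| j))).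
    exact: delta_dvdn (rem_uniq _ (primes_uniq _)) (rem_pr _) m_gt0.
  move=> d d_p; rewrite step ?eqxx // Gauss_dvdr // coprime_sym prime_coprime //.
  by rewrite gtnNdvd //; have := prime_gt1 p_pr; lia.
(* For the prime [r] found here, [e %| r * j] and [e %| j] are equivalent at
   all points, since [n / r] and these have the same [r]-adic valuation. *)
have [r [r_n r_p r_e]] : exists r, [/\ r \in primes n, r != p & logn r e < logn r n].
  have [p_in|p_in] := boolP (p \in primes n).
    exists (max_pdiv n); rewrite pi_max_pdiv n_gt1 sp; split=> //.
    have s_in : max_pdiv n \in primes n by rewrite pi_max_pdiv.
    rewrite logm // ltnS logn_coprime // prime_coprime ?primes_pr // gtnNdvd //.
    by have := max_pdiv_max p_in; have := prime_gt1 p_pr; lia.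
  have q_gt1 : 1 < n %/ e.
    by rewrite ltn_divRL // mul1n ltn_neqAle e_neq dvdn_leq.
  have r_pr := pdiv_prime q_gt1.
  have r_n : pdiv (n %/ e) \in primes n.
    by rewrite mem_primes r_pr n_gt0 (dvdn_trans (pdiv_dvd _)) // dvdn_div.
  exists (pdiv (n %/ e)); split=> //; first by apply: contra p_in => /eqP<-.
  rewrite -[X in _ < logn _ X](divnK e_n) lognM //; last exact: ltnW.
  by rewrite -[ltnLHS]add0n ltn_add2r logn_gt0 mem_primes r_pr ltnW // pdiv_dvd.
rewrite (delta_rem _ _ r_n) (@delta_ext _ _ (fun=> 0%R)) ?delta0 // => d d_r.
rewrite step //; first by rewrite eq_sym (negPf r_p).
have d_gt0 : 0 < d by case: d {d_r} (notdvd r d r_n d_r) => //; rewrite dvdn0.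
rewrite dvdn_mul_prime ?primes_pr ?muln_gt0 ?d_gt0 // logn_mul_notdvd ?notdvd ?primes_pr //.
by rewrite -ltnS -logm.
Qed.

(** The Moebius product of the norms, here a quotient of two products, is the
    norm of the [n]-th cyclotomic polynomial at [+-(1 + i)]: without primitive
    prime divisors, only the largest prime of [n] can remain in it, once. *)
Lemma no_primitive_dvd b n m : odd n -> 1 < n ->
    n = \prod_(r <- primes n) r * m ->
    (forall p, prime p -> p %| gauss_norm b n ->
       ~~ primitive_prime_divisor 2 (4 * n) p) ->
  \prod_(d <- signed_points true (primes n) m) gauss_norm b d
   %| max_pdiv n * \prod_(d <- signed_points false (primes n) m) gauss_norm b d.
Proof.
move=> n_odd n_gt1 nE no_ppd.
have points_n c d : d \in signed_points c (primes n) m -> d %| n.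
  by move=> /signed_points_mul[a a_n ->]; rewrite [X in _ %| X]nE dvdn_mul.
have gn_gt0 c : {in signed_points c (primes n) m, forall d, 0 < gauss_norm b d}.
  by move=> d /points_n d_n; rewrite gauss_norm_gt0 // (dvdn_odd d_n).
have prod_gt0 c : 0 < \prod_(d <- signed_points c (primes n) m) gauss_norm b d.
  by rewrite big_seq; apply: prodn_cond_gt0 => d /gn_gt0.
have s_pr := max_pdiv_prime n_gt1.
apply/dvdn_partP => // p; rewrite mem_primes p_part => /and3P[p_pr _ _].
rewrite pfactor_dvdn ?muln_gt0 ?max_pdiv_gt0 ?prod_gt0 //.
rewrite [X in _ <= X]lognM ?max_pdiv_gt0 ?prod_gt0 //.
have [p_n|p_n] := boolP (p %| gauss_norm b n); last first.
  rewrite logn_prod //; rewrite big_seq big1 // => d /points_n /dvdnP[r nr].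
  rewrite logn_coprime // prime_coprime //; apply: contra p_n => /dvdn_trans; apply.
  by rewrite nr mulnC gauss_norm_dvd.
have [|e [e_n e_p ord_p p_e]] := @order_of_minus1 p n n_odd p_pr.
  by rewrite -(gauss_norm_mul b) // dvdn_mulr.
have e_neq : e != n.
  apply: contra (no_ppd p p_pr p_n) => /eqP en.
  by apply: primitive_of_order => // j; rewrite -en.
have := delta_logn_gauss_norm n_odd n_gt1 nE p_pr p_n e_n e_neq e_p p_e.
rewrite delta_signed_points !logn_prod // (logn_prime _ s_pr) [p == _]eq_sym.
by rewrite -!sum_Posz lerBlDr -PoszD lez_nat.
Qed.

(** * Existence of primitive prime divisors *)

(** The quotient of [no_primitive_dvd] is about [2 ^ phi], where
    [phi = m * \prod (r - 1)] is the totient of [n].  In the numerator a norm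
    at [d] is at least [4 ^ d] divided by the larger factor, in the denominator
    it is at most that factor; so the total error is a product over distinct
    odd numbers, to which [prod_aurifeuille_le] applies. *)
Lemma no_primitive_small b n m : odd n -> 1 < n ->
    n = \prod_(r <- primes n) r * m ->
    (forall p, prime p -> p %| gauss_norm b n ->
       ~~ primitive_prime_divisor 2 (4 * n) p) ->
  8 * 2 ^ (m * \prod_(r <- primes n) r.-1) <= 65 * max_pdiv n.
Proof.
move=> n_odd n_gt1 nE no_ppd.
have n_gt0 := ltnW n_gt1.
have m_gt0 : 0 < m by move: n_gt0; rewrite nE muln_gt0 => /andP[].
have primes_pr : all prime (primes n) by apply/allP => r; rewrite mem_primes => /andP[].
have := no_primitive_dvd n_odd n_gt1 nE no_ppd.
have points_odd c : all odd (signed_points c (primes n) m).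
  apply/allP => d /signed_points_mul[a a_n ->]; apply: dvdn_odd n_odd.
  by rewrite [X in _ %| X]nE dvdn_mul.
have := signed_points_uniq (primes_uniq n) primes_pr m_gt0.
have := delta_signed_points (primes n) Posz m.
rewrite delta_id.
move: (signed_points true _ _) (signed_points false _ _)
  (points_odd true) (points_odd false) => P M P_odd M_odd.
have -> : (\prod_(r <- primes n) (r%:Z - 1) = Posz (\prod_(r <- primes n) r.-1))%R.
  elim: (primes n) primes_pr => [|r s IH] /=; first by rewrite !big_nil.
  by move=> /andP[r_pr /IH IHs]; rewrite !big_cons IHs PoszM predn_int ?(prime_gt0 r_pr).
rewrite -!sum_Posz => phiE PM_uniq.
have {phiE} : \sum_(d <- P) d = \sum_(d <- M) d + m * \prod_(r <- primes n) r.-1 by lia.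
move: (m * _) => phi phiE /dvdn_leq ND.
have := prod_aurifeuille_le PM_uniq; rewrite all_cat P_odd M_odd => /(_ isT).
rewrite !big_cat /= phiE => PM_le.
have s_gt0 : 0 < max_pdiv n by exact: max_pdiv_gt0.
have gn_gt0 s : all odd s -> 0 < \prod_(d <- s) gauss_norm b d.
  move=> /allP s_odd; rewrite big_seq.
  by apply: prodn_cond_gt0 => d /s_odd; apply: gauss_norm_gt0.
have {}ND := ND (_ : 0 < max_pdiv n * _).
rewrite muln_gt0 s_gt0 gn_gt0 // in ND; have {}ND := ND isT.
have D_le : \prod_(d <- M) gauss_norm b d <= \prod_(d <- M) aurifeuille true d.
  rewrite big_seq [leqRHS]big_seq; apply: leq_prod => d /(allP M_odd).
  exact: gauss_norm_le.
have N_ge : 4 ^ (\sum_(d <- P) d) <=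
    \prod_(d <- P) gauss_norm b d * \prod_(d <- P) aurifeuille true d.
  rewrite -big_split expn_sum /= big_seq [leqRHS]big_seq.
  apply: leq_prod => d /(allP P_odd) d_odd.
  apply: leq_trans (_ : gauss_norm b d * gauss_norm (~~ b) d <= _).
    by rewrite gauss_norm_mul // leq_addr.
  by rewrite leq_mul2l gauss_norm_le ?orbT.
move: N_ge PM_le ND D_le.
rewrite phiE -[4 ^ _]/((2 ^ 2) ^ _) -expnM mul2n -addnn addnA [2 ^ (_ + phi)]expnD.
have : 0 < 2 ^ (\sum_(d <- M) d + phi + \sum_(d <- M) d) by rewrite expn_gt0.
move: (2 ^ _) (2 ^ phi) (\prod_(d <- P) gauss_norm b d) (\prod_(d <- M) gauss_norm b d).
move: (\prod_(d <- P) _) (\prod_(d <- M) _) (max_pdiv n).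
move=> TP TM s K F N D K_gt0 N_ge T_le ND D_le.
rewrite -(leq_pmul2l K_gt0).
apply: leq_trans (_ : s * (8 * (TP * TM)) <= _); last first.
  by rewrite [65 * s]mulnC [leqRHS]mulnCA leq_mul2l [K * _]mulnC T_le orbT.
apply: leq_trans (_ : 8 * (N * TP) <= _); first by rewrite [leqLHS]mulnCA leq_mul2l N_ge orbT.
rewrite [leqRHS]mulnCA leq_mul2l [TP * TM]mulnC mulnA leq_mul2r /=.
by rewrite (leq_trans ND) ?orbT // leq_mul2l D_le orbT.
Qed.

(** The totient of [n] is at least [s - 1], [s] the largest prime of [n], which
    suffices for [s >= 7].  For [s = 5] and [s = 3] the condition [7 <= n] gives
    [n] another prime factor, possibly equal, and raises the totient to at
    least 8 and 6. *)
Lemma prime_lt_pow_totient n m : odd n -> 7 <= n ->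
    n = \prod_(r <- primes n) r * m ->
  65 * max_pdiv n < 8 * 2 ^ (m * \prod_(r <- primes n) r.-1).
Proof.
move=> n_odd n7 nE.
have primes_ge3 r : r \in primes n -> 3 <= r.
  rewrite mem_primes => /and3P[r_pr _ r_n].
  by have := prime_gt1 r_pr; have := dvdn_odd r_n n_odd; case: r {r_pr r_n} => [|[|[|]]].
have m_gt0 : 0 < m by case: m nE n7 => // ->; rewrite muln0.
have s_in : max_pdiv n \in primes n by rewrite pi_max_pdiv; lia.
have s_max r : r \in primes n -> r <= max_pdiv n by apply: max_pdiv_max.
have s_odd : odd (max_pdiv n) by apply: dvdn_odd (max_pdiv_dvd n) n_odd.
move: (max_pdiv n) s_in s_max s_odd => s s_in s_max s_odd.
have nE' : n = s * \prod_(r <- rem s (primes n)) r * m by rewrite [LHS]nE (big_rem s).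
rewrite (big_rem s) //=; have := primes_ge3 s s_in => s3.
have rem_in r : r \in rem s (primes n) -> r != s /\ r \in primes n.
  by rewrite mem_rem_uniq ?primes_uniq // !inE => /andP[].
move: (rem s (primes n)) rem_in nE' => t t_in nE'.
have t_gt0 u : {subset u <= t} -> 0 < \prod_(r <- u) r.-1.
  move=> ut; rewrite big_seq; apply: prodn_cond_gt0 => r /ut/t_in[_ /primes_ge3]; lia.
set phi := m * _.
(* It suffices to bound the totient [phi] of [n] from below. *)
have enough k : k <= phi -> 65 * s < 8 * 2 ^ k -> 65 * s < 8 * 2 ^ phi.
  by move=> k_phi /leq_trans; apply; rewrite leq_mul2l leq_exp2l.
have T_gt0 : 0 < \prod_(r <- t) r.-1 by apply: t_gt0.
have [s7|s_lt7] := leqP 7 s.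
  apply: (enough s.-1); first by rewrite /phi mulnCA leq_pmulr // muln_gt0 m_gt0.
  rewrite -(subnK s7); elim: (s - 7) => [|d IH] //.
  by move: IH; rewrite addSn [d + 7]addnS /= expnS; lia.
have [s5|s_3] : s = 5 \/ s = 3 by lia.
- apply: (enough 8); last by rewrite s5.
  rewrite /phi s5 /=.
  have [t0|[r [u tE]]] : t = [::] \/ exists r u, t = r :: u.
    by case: (t) => [|r u]; [left | right; exists r, u].
    by move: nE'; rewrite t0 s5 !big_nil; lia.
  have r_t : r \in t by rewrite tE inE eqxx.
  have [_ /primes_ge3 r3] := t_in r r_t.
  have u_gt0 : 0 < \prod_(r <- u) r.-1.
    by apply: t_gt0 => x xu; rewrite tE inE xu orbT.
  rewrite tE big_cons /= mulnA -[8]/(4 * 2); apply: leq_mul; first by lia.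
  by rewrite -[2]muln1 leq_mul //; lia.
- apply: (enough 6); last by rewrite s_3.
  have t0 : t = [::].
    case tE: t => [//|r u]; have [] := t_in r; first by rewrite tE inE eqxx.
    by move=> /eqP r_s r_n; have := primes_ge3 r r_n; have := s_max r r_n; lia.
  by move: nE'; rewrite /phi t0 !big_nil s_3 /=; lia.
Qed.

Lemma primitive_gauss_norm b n : odd n -> 7 <= n ->
  exists2 p, primitive_prime_divisor 2 (4 * n) p & p %| gauss_norm b n.
Proof.
move=> n_odd n7; have n_gt1 : 1 < n by lia.
have n_gt0 := ltnW n_gt1.
have [m nE] : exists m, n = \prod_(r <- primes n) r * m.
  by exists (n %/ \prod_(r <- primes n) r); rewrite mulnC divnK ?dvdn_prod_primes.
have [/hasP[p]|no_ppd] :=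
    boolP (has (primitive_prime_divisor 2 (4 * n)) (primes (gauss_norm b n))).
  by rewrite mem_primes => /and3P[_ _ p_n] p_ppd; exists p.
have := prime_lt_pow_totient n_odd n7 nE.
rewrite ltnNge (@no_primitive_small b) // => p p_pr p_n.
by apply: (hasPn no_ppd); rewrite mem_primes p_pr gauss_norm_gt0.
Qed.

Lemma primitive_small n p : odd n -> prime p -> p %| 4 ^ n + 1 ->
    (forall e, e %| n -> p %| 4 ^ e + 1 -> e = n) ->
  primitive_prime_divisor 2 (4 * n) p.
Proof.
move=> n_odd p_pr p_n minimal.
have [e [e_n _ ord_p p_e]] := order_of_minus1 n_odd p_pr p_n.
by apply: primitive_of_order => // j; rewrite ord_p (minimal e) // p_e // (dvdn_odd e_n).
Qed.

(** Which of the two norms equals [t+] depends on [n] modulo 8, but both have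
    a primitive prime divisor for [n >= 7].  For [n = 1, 3, 5] the values of
    [t+] are the primes 5, 13, 41. *)
Lemma primitive_aurifeuille n (s : bool) : odd n -> 7 <= n \/ s ->
  exists2 p, primitive_prime_divisor 2 (4 * n) p & p %| aurifeuille s n.
Proof.
move=> n_odd.
have [n7 _|n_lt7 [//|->]] := leqP 7 n.
  have [c E] := gauss_normE n_odd.
  have [p] := primitive_gauss_norm (s (+) c) n_odd n7.
  by exists p; rewrite // -[s](addbK c) -E.
have [->|[->|->]] : n = 1 \/ n = 3 \/ n = 5.
  by case: n n_odd n_lt7 => [|[|[|[|[|[|[|]]]]]]]; auto.
- exists 5; last by [].
  by apply: primitive_small => // e; rewrite dvdn1 => /eqP->.
- exists 13; last by [].
  apply: primitive_small => // e.
  by have /primeP[_ dvd3] : prime 3 by []; move=> /dvd3/pred2P[->|->].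
- exists 41; last by [].
  apply: primitive_small => // e.
  by have /primeP[_ dvd5] : prime 5 by []; move=> /dvd5/pred2P[->|->].
Qed.

Lemma dvd_aurifeuille p s n : odd n -> p %| aurifeuille s n ->
  p %| (2 ^ n) ^ 2 + 1.
Proof.
move=> n_odd p_n; rewrite -expnM mulnC expnM -aurifeuille_mul //.
by case: s p_n => p_n; [apply: dvdn_mulr | apply: dvdn_mull].
Qed.

Lemma sqrtC_double_pow n : odd n ->
  sqrtC (2 * 2 ^ n)%:R%R = (2 ^ n.+1./2)%:R%R :> algC.
Proof.
move=> n_odd.
have -> : 2 * 2 ^ n = (2 ^ n.+1./2) ^ 2 by rewrite -expnS -expnM; congr (_ ^ _); lia.
by rewrite natrX sqrCK // ler0n.
Qed.

Lemma tplusE n : odd n -> tplus (2 ^ n) = (aurifeuille true n)%:R%R.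
Proof.
by move=> n_odd; rewrite /tplus sqrtC_double_pow // /aurifeuille !natrD addrAC.
Qed.

Lemma tminusE n : odd n -> tminus (2 ^ n) = (aurifeuille false n)%:R%R.
Proof.
move=> n_odd; rewrite /tminus sqrtC_double_pow // /aurifeuille.
have s_le : 2 ^ n.+1./2 <= 2 ^ n by rewrite leq_exp2l; lia.
by rewrite (natrB _ (leq_trans s_le (leq_addr 1 _))) natrD addrAC.
Qed.

Theorem theorem3p4 (n q : nat) (n_ge1 : (1 <= n)%N) (n_odd : odd n)
    (q_def : q = (2 ^ n)%N) :
  ((7 <= n)%N ->
     exists p : nat,
       [/\ primitive_prime_divisor 2 (4 * n) p, (p %| q ^ 2 + 1)%N
         & (p %| tminus q)%C])
  /\ (exists p : nat,
       [/\ primitive_prime_divisor 2 (4 * n) p, (p %| q ^ 2 + 1)%N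
         & (p %| tplus q)%C]).
Proof.
rewrite q_def; split=> [n7|].
- have [p p_ppd p_n] := @primitive_aurifeuille n false n_odd (or_introl n7).
  exists p; split=> //; first exact: dvd_aurifeuille p_n.
  by rewrite tminusE // dvdC_nat.
have [p p_ppd p_n] := @primitive_aurifeuille n true n_odd (or_intror isT).
exists p; split=> //; first exact: dvd_aurifeuille p_n.
by rewrite tplusE // dvdC_nat.
Qed.
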